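(* The following eight mesh patterns $(12,R)$ are pairwise equidistributed, where $R$ ranges over: $\{(0,2),(1,2),(2,2),(2,1)\}$, $\{(0,2),(0,1),(0,0),(1,0)\}$, $\{(1,2),(2,2),(2,1),(2,0)\}$, $\{(0,1),(0,0),(1,0),(2,0)\}$, $\{(0,2),(1,2),(2,2),(2,0)\}$, $\{(0,2),(2,2),(2,1),(2,0)\}$, $\{(0,2),(0,1),(0,0),(2,0)\}$, $\{(0,2),(0,0),(1,0),(2,0)\}$. Moreover, for each such pattern $p$, $s_{n,n-1}(p)=(n-1)!$ for $n\ge1$, and for $n\ge 2$ and $0\le k\le n-2$, $$s_{n,k}(p)=\frac{n!}{(k+1)(k+2)}.$$
   Context: For $R\subseteq\{0,1,2\}^2$ and $\pi=\pi_1\cdots\pi_n\in S_n$, an occurrence of the mesh pattern $(12,R)$ in $\pi$ is a pair of positions $i_1<i_2$ with $\pi_{i_1}<\pi_{i_2}$ such that, setting $x_0=0,x_1=i_1,x_2=i_2,x_3=n+1$ and $y_0=0,y_1=\pi_{i_1},y_2=\pi_{i_2},y_3=n+1$, for every $(a,b)\in R$ there is no index $k$ with $x_a<k<x_{a+1}$ and $y_b<\pi_k<y_{b+1}$. $s_{n,k}(p)$ is the number of $\pi\in S_n$ with exactly $k$ occurrences of $p$; $p_1,p_2$ are equidistributed if $s_{n,k}(p_1)=s_{n,k}(p_2)$ for all $n,k\ge 0$. *)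

(* Defs.v *)
From mathcomp Require Import all_boot all_order all_fingroup all_algebra.
Set Implicit Arguments.
Unset Strict Implicit.
Unset Printing Implicit Defensive.
Import GRing.Theory Num.Theory.

(* A shading of the mesh pattern (12, R): the cell (a, b) is in column a
   (positions, left to right) and row b (values, bottom to top). *)
Definition shading := {set 'I_3 * 'I_3}.

(* The grid lines z_0 = 0 < z_1 = u < z_2 = v < z_3 = n + 1. *)
Definition gridline (n u v a : nat) : nat := nth 0 [:: 0; u; v; n.+1] a.

(* MathComp permutations act on {0, ..., n-1}; the successors shift positions
   and values to {1, ..., n}. *)
Definition mesh_occurrence (R : shading) (n : nat) (pi : 'S_n) (i j : 'I_n) :
    bool :=
  let x := gridline n i.+1 j.+1 in
  let y := gridline n (pi i).+1 (pi j).+1 in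
  [&& i < j, pi i < pi j &
      [forall c in R, ~~ [exists k : 'I_n,
         (x c.1 < k.+1 < x c.1.+1) && (y c.2 < (pi k).+1 < y c.2.+1)]]].

Definition mesh_count (R : shading) (n : nat) (pi : 'S_n) : nat :=
  #|[set ij : 'I_n * 'I_n | mesh_occurrence R pi ij.1 ij.2]|.

(* s_{n,k}((12, R)) *)
Definition mesh_distr (R : shading) (n k : nat) : nat :=
  #|[set pi : 'S_n | mesh_count R pi == k]|.

Definition equidistributed (R1 R2 : shading) : Prop :=
  forall n k : nat, mesh_distr R1 n k = mesh_distr R2 n k.

(* The numerals are elements of 'I_3. *)
Definition eight_shadings : seq shading :=
  [:: [set (0, 2); (1, 2); (2, 2); (2, 1)];
      [set (0, 2); (0, 1); (0, 0); (1, 0)];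
      [set (1, 2); (2, 2); (2, 1); (2, 0)];
      [set (0, 1); (0, 0); (1, 0); (2, 0)];
      [set (0, 2); (1, 2); (2, 2); (2, 0)];
      [set (0, 2); (2, 2); (2, 1); (2, 0)];
      [set (0, 2); (0, 1); (0, 0); (2, 0)];
      [set (0, 2); (0, 0); (1, 0); (2, 0)]]%R.

(* Main.v *)
(* Inversion and reverse-complement preserve the underlying pattern 12 and move
   the shaded cells by the corresponding symmetry of the square, so only the
   shadings {02,12,22,21} and {02,12,22,20} need to be counted.  For these the
   second letter of an occurrence is the maximum n, and the first letter is
   larger (resp. smaller) than every letter to the right of n.  Hence the count
   is the length of the longest initial run of n-1, n-2, ... (resp. 1, 2, ...)
   lying to the left of n.  It equals k < n-1 exactly when, among k+2 prescribed
   values, n occupies the second-to-last position and one prescribed value the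
   last one, an event of probability 1/((k+1)(k+2)). *)
Require Import Defs.
From mathcomp Require Import all_boot all_order all_fingroup all_algebra.
From mathcomp Require Import zify.
Set Implicit Arguments.
Unset Strict Implicit.
Unset Printing Implicit Defensive.
Import GRing.Theory Num.Theory.

Lemma card_ord_lt N m : m <= N -> #|[set t : 'I_N | t < m]| = m.
Proof.
move=> mN; have widen_inj : injective (widen_ord mN).
  by move=> i j /(congr1 val)/= ij; apply: val_inj.
rewrite -[RHS]card_ord -(card_imset _ widen_inj).
apply: eq_card => t; rewrite !inE; apply/idP/imsetP => [tm|[u _ ->]].
  by exists (Ordinal tm); rewrite ?inE //; apply: val_inj.
by rewrite /= ltn_ord.
Qed.

(** * Permutations by the place of their maximum over a set *)

Section ArgMax.

Variable n : nat.
Implicit Types (s q : 'S_n) (D : {set 'I_n}).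

Definition argmax s D a := [forall x in D, s x <= s a].

Lemma argmax_uniq s D a b :
  a \in D -> b \in D -> argmax s D a -> argmax s D b -> a = b.
Proof.
move=> aD bD /forall_inP/(_ b bD) ba /forall_inP/(_ a aD) ab.
by apply: (@perm_inj _ s); apply/val_inj/anti_leq; rewrite ab ba.
Qed.

Lemma tperm_stable D x y z : x \in D -> y \in D -> (tperm x y z \in D) = (z \in D).
Proof. by move=> xD yD; case: tpermP => [->|->|//]; rewrite xD yD. Qed.

Lemma argmax_tperm s D x y a : x \in D -> y \in D ->
  argmax s D a -> argmax (tperm x y * s)%g D (tperm x y a).
Proof.
move=> xD yD /forall_inP sa; apply/forall_inP => z zD.
by rewrite !permM tpermK sa // tperm_stable.
Qed.

(* The events "s attains its maximum over D at x", for x in D, partition P, and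
   transpositions within D exchange them. *)
Lemma card_argmax (P : pred 'S_n) D a : a \in D ->
  (forall x y s, x \in D -> y \in D -> P s -> P (tperm x y * s)%g) ->
  #|[set s | P s & argmax s D a]| * #|D| = #|[set s | P s]|.
Proof.
move=> aD Ptperm.
have card_le x y : x \in D -> y \in D ->
    #|[set s | P s & argmax s D x]| <= #|[set s | P s & argmax s D y]|.
  move=> xD yD; rewrite -(card_imset _ (mulgI (tperm x y))).
  apply/subset_leq_card/subsetP => _ /imsetP[s + ->]; rewrite !inE.
  case/andP=> Ps sx; rewrite Ptperm //=.
  by have := argmax_tperm xD yD sx; rewrite tpermL.
transitivity (\sum_(x in D) #|[set s | P s & argmax s D x]|).
  rewrite mulnC -sum_nat_const; apply: eq_bigr => x xD.
  by apply/eqP; rewrite eqn_leq !card_le.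
rewrite -sum1_card; under eq_bigr do rewrite -sum1_card big_mkcond /=.
rewrite exchange_big [RHS]big_mkcond /=; apply: eq_bigr => s _.
under eq_bigr do rewrite inE.
rewrite inE; case: (P s) => /=; last by rewrite big1.
(* For fixed [s] satisfying [P], exactly one point of [D] carries the maximum, so [s] is counted
   once. *)
case: (@arg_maxnP _ a (mem D) (fun x => s x) aD) => m mD maxm.
have sm : argmax s D m by apply/forall_inP => x /maxm.
rewrite (bigD1 m) //= sm big1 // => x /andP[xD xm].
by case: ifP => // sx; rewrite (argmax_uniq xD mD sx sm) eqxx in xm.
Qed.

(** The maximum over [D] falls at [b] with probability 1/|D|. Transpositions within [D :\ b] fix [b]
    and preserve this event, so given it the maximum over the rest falls at [a] with probability
    1/(|D|-1). *)
Lemma card_second_argmax D a b : a \in D -> b \in D -> a != b ->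
  #|[set s | argmax s D b & argmax s (D :\ b) a]| * (#|D|.-1 * #|D|) = n`!.
Proof.
move=> aD bD ab.
have cardD : #|D :\ b| = #|D|.-1 by rewrite (cardsD1 b D) bD.
have /= := @card_argmax predT D b bD (fun _ _ _ _ _ _ => isT).
rewrite mulnA -cardD card_argmax; first by move=> ->; rewrite cardsT card_Sn.
  by rewrite !inE ab.
move=> x y s; rewrite !inE => /andP[xb xD] /andP[yb yD].
by move/(argmax_tperm xD yD); rewrite tpermD.
Qed.

End ArgMax.

(** * Initial runs to the left of the maximum *)

Section Prefix.

Variables (N : nat) (e : 'I_N -> 'I_N.+1).
Hypotheses (e_inj : injective e) (e_max : forall t, e t != ord_max).

(** Here [q] sends values to positions and [e] lists non-maximal values. The counted indices form an
    initial segment, so their number is the length of the longest run e 0, e 1, ... to the left of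
    the maximum. *)
Definition prefix_count (q : 'S_N.+1) :=
  #|[set t : 'I_N | [forall (u : 'I_N | u <= t), q (e u) < q ord_max]]|.

Lemma prefix_count_geP (q : 'S_N.+1) k : k <= N ->
  reflect (forall t : 'I_N, t < k -> q (e t) < q ord_max) (k <= prefix_count q).
Proof.
move=> kN; rewrite /prefix_count; set S := [set _ | _].
apply: (iffP idP) => [kS t tk|qk]; last first.
  rewrite -{1}(card_ord_lt kN); apply/subset_leq_card/subsetP => t.
  rewrite !inE => tk; apply/forall_inP => u ut; apply: qk.
  exact: leq_ltn_trans tk.
rewrite ltnNge; apply/negP => qt.
suff: #|S| <= t by move/(leq_trans kS); rewrite leqNgt tk.
rewrite -[leqRHS](card_ord_lt (ltnW (ltn_ord t))); apply/subset_leq_card/subsetP => u.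
rewrite !inE => /forall_inP Su; rewrite ltnNge; apply/negP => /Su.
by rewrite ltnNge qt.
Qed.

Lemma prefix_count_le q : prefix_count q <= N.
Proof. by rewrite -[leqRHS]card_ord max_card. Qed.

Lemma card_prefix_count_lt k : k < N ->
  #|[set q | prefix_count q == k]| * (k.+1 * k.+2) = N.+1`!.
Proof.
move=> kN; pose b := e (Ordinal kN).
(* The run has length exactly k when, among these k+2 values, [b] = e k is rightmost and the maximum
   comes next to it. *)
pose D := ord_max |: [set e t | t in [set t : 'I_N | t <= k]].
have eD t : (e t \in D) = (t <= k).
  by rewrite in_setU1 (negPf (e_max t)) /= mem_imset // inE.
have maxD : ord_max \in D by rewrite !inE eqxx.
have bD : b \in D by rewrite eD /=.
have cardD : #|D| = k.+2.
  rewrite cardsU1; have -> : ord_max \notin [set e t | t in [set t : 'I_N | t <= k]].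
    by apply/imsetP => -[t _ /eqP]; rewrite eq_sym (negPf (e_max t)).
  by rewrite card_imset // (card_ord_lt kN).
have bmax : ord_max != b by rewrite eq_sym e_max.
rewrite -(card_second_argmax maxD bD bmax) cardD; congr (_ * _).
apply: eq_card => q; rewrite !inE eqn_leq leqNgt andbC.
apply/andP/andP => [[/(elimT (prefix_count_geP q (ltnW kN))) lek]|].
  move=> /(elimN (prefix_count_geP q kN)) ltk.
  have bq : q ord_max < q b.
    rewrite ltn_neqAle; apply/andP; split.
      by rewrite (inj_eq val_inj) (inj_eq perm_inj).
    rewrite leqNgt; apply/negP => qb; apply: ltk => t; rewrite ltnS leq_eqVlt.
    case/orP => [/eqP tk|/lek//].
    by have -> : t = Ordinal kN by apply: val_inj.
  have qmax x : x \in D :\ b -> q x <= q ord_max.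
    rewrite !inE => /andP[xb /orP[/eqP->//|/imsetP[t]]].
    rewrite inE leq_eqVlt => /orP[/eqP tk|/lek/ltnW ? ->//] xt.
    by case/eqP: xb; rewrite xt; congr e; apply: val_inj.
  split; apply/forall_inP => // x xD.
  have [->//|xb] := eqVneq x b.
  by apply: leq_trans (ltnW bq); rewrite qmax // !inE xb; rewrite in_setU1 in xD.
case=> /forall_inP/(_ _ maxD) bq /forall_inP qmax.
split.
  apply/prefix_count_geP => [|t tk]; first exact: ltnW.
  rewrite ltn_neqAle (inj_eq val_inj) (inj_eq perm_inj) e_max qmax //.
  by rewrite in_setD1 eD (ltnW tk) (inj_eq e_inj) -(inj_eq val_inj) /= (ltn_eqF tk).
by apply/prefix_count_geP => // /(_ (Ordinal kN) (ltnSn k)); rewrite ltnNge bq.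
Qed.

Hypothesis e_onto : forall x : 'I_N.+1, x != ord_max -> exists t, e t = x.

(** The run is complete exactly when the maximum is the last letter, an event of probability
    1/(N+1). *)
Lemma card_prefix_count_max : #|[set q | prefix_count q == N]| = N`!.
Proof.
apply/eqP; rewrite -(eqn_pmul2r (ltn0Sn N)) [X in _ == X]mulnC -factS.
have /= := @card_argmax N.+1 predT setT ord_max (in_setT _) (fun _ _ _ _ _ _ => isT).
rewrite !cardsT card_ord card_Sn => <-; rewrite eqn_pmul2r //; apply/eqP.
apply: eq_card => q; rewrite !inE eqn_leq prefix_count_le /=.
apply/prefix_count_geP/forall_inP => // [qN x _|qN t _].
  by have [->//|/e_onto[t <-]] := eqVneq x ord_max; rewrite ltnW ?qN.
by rewrite ltn_neqAle (inj_eq val_inj) (inj_eq perm_inj) e_max qN.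
Qed.

End Prefix.

Lemma forall_in_set4 (T : finType) (P : pred T) a b c d :
  [forall x in [set a; b; c; d], P x] = [&& P a, P b, P c & P d].
Proof.
apply/forall_inP/and4P => [Pall|[Pa Pb Pc Pd] x].
  by split; apply: Pall; rewrite !inE eqxx ?orbT.
by rewrite !inE => /orP[/orP[/orP[]|]|] /eqP->.
Qed.

Lemma card_fiber (T : finType) (F : T -> T) (a b : T -> nat) k :
  injective F -> (forall x, a x = b (F x)) ->
  #|[set x | a x == k]| = #|[set x | b x == k]|.
Proof.
move=> F_inj aF; rewrite -[RHS](card_preimset _ F_inj).
by apply: eq_card => x; rewrite !inE aF.
Qed.

(** * From mesh occurrences to initial runs *)

Section PrefixShading.

(* An occurrence ends at the maximum and starts at a value e t all of whose
   r-predecessors e u, u <= t, lie to the left of the maximum. *)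
Variables (N : nat) (R : shading) (e : 'I_N -> 'I_N.+1) (r : rel 'I_N.+1).
Hypotheses (e_inj : injective e) (e_max : forall t, e t != ord_max).
Hypothesis e_onto : forall x : 'I_N.+1, x != ord_max -> exists t, e t = x.
Hypothesis e_mono : forall u t, r (e u) (e t) = (u <= t).
Hypothesis occurrenceP : forall (pi : 'S_N.+1) (i j : 'I_N.+1),
  reflect [/\ i < j, pi j = ord_max &
             forall k : 'I_N.+1, j < k -> ~~ r (pi k) (pi i)]
          (mesh_occurrence R pi i j).

Lemma mesh_count_prefix (pi : 'S_N.+1) : mesh_count R pi = prefix_count e pi^-1%g.
Proof.
pose f t := ((pi^-1)%g (e t), (pi^-1)%g ord_max).
have f_inj : injective f by move=> u t [/perm_inj/e_inj].
rewrite /prefix_count -(card_imset _ f_inj); apply: eq_card => -[i j].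
rewrite !inE; apply/occurrenceP/imsetP => /= [[ij pj rji]|[t]].
  have pi_max : pi i != ord_max.
    by rewrite -pj (inj_eq perm_inj) -(inj_eq val_inj) ltn_eqF.
  have [t et] := e_onto pi_max; exists t; last by rewrite /f et -pj !permK.
  (* The value [e u] is not at [j], which holds the maximum, nor to its right, being an
     [r]-predecessor of [e t]. *)
  rewrite inE; apply/forall_inP => u ut; rewrite -pj permK ltnNge leq_eqVlt.
  apply/norP; split.
    apply: contraNneq (e_max u) => /val_inj ju.
    by rewrite -pj ju permKV.
  by apply/negP => /rji; rewrite permKV -et e_mono ut.
rewrite inE => /forall_inP tq [-> ->]; rewrite !permKV.
split=> [||k jk]; [exact: tq | by [] |].
have kmax : pi k != ord_max.
  by apply: contraTneq jk => <-; rewrite permK ltnn.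
have [u eu] := e_onto kmax; rewrite -eu e_mono.
by apply: contraTN jk => /tq; rewrite eu permK -leqNgt => /ltnW.
Qed.

Lemma mesh_distr_prefix k :
  mesh_distr R N.+1 k = #|[set q | prefix_count e q == k]|.
Proof.
apply: (card_fiber (F := fun q : 'S_N.+1 => q^-1%g)); first exact: invg_inj.
exact: mesh_count_prefix.
Qed.

End PrefixShading.

(** Stated for n = N+1 and without division. The three clauses fix the distribution for every n >=
    1, so any two shadings obeying the law are equidistributed. *)
Definition distr_law (R : shading) := forall N k,
  [/\ k < N -> mesh_distr R N.+1 k * (k.+1 * k.+2) = N.+1`!,
      k = N -> mesh_distr R N.+1 k = N`!
    & N < k -> mesh_distr R N.+1 k = 0].

Lemma prefix_distr_law R
    (e : forall N, 'I_N -> 'I_N.+1) (r : forall N, rel 'I_N.+1) :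
  (forall N, injective (@e N)) -> (forall N (t : 'I_N), e N t != ord_max) ->
  (forall N (x : 'I_N.+1), x != ord_max -> exists t, e N t = x) ->
  (forall N (u t : 'I_N), r N (e N u) (e N t) = (u <= t)) ->
  (forall N (pi : 'S_N.+1) (i j : 'I_N.+1),
    reflect [/\ i < j, pi j = ord_max &
               forall k : 'I_N.+1, j < k -> ~~ r N (pi k) (pi i)]
            (mesh_occurrence R pi i j)) ->
  distr_law R.
Proof.
move=> e_inj e_max e_onto e_mono occP N k.
rewrite (mesh_distr_prefix (e_inj N) (e_max N) (e_onto N) (e_mono N) (occP N)).
split=> [kN|->|Nk]; first exact: (card_prefix_count_lt (e_inj N) (e_max N)).
  exact: (card_prefix_count_max (e_max N) (e_onto N)).
apply: eq_card0 => q; rewrite inE; apply/negP => /eqP kq.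
by have := prefix_count_le (@e N) q; rewrite kq leqNgt Nk.
Qed.

(** * The two basic shadings *)

Lemma perm_val_neq n (pi : 'S_n) (i j : 'I_n) : i != j :> nat -> pi i != pi j :> nat.
Proof. by rewrite !(inj_eq val_inj) (inj_eq perm_inj). Qed.

(** The maximum cannot lie strictly inside a column, nor at [i] because [pi i < pi j]; only [j]
    remains. *)
Lemma top_row_empty N (pi : 'S_N.+1) (i j : 'I_N.+1) : i < j -> pi i < pi j ->
  (forall k : 'I_N.+1, ~~ ((0 < k.+1 < i.+1) && ((pi j).+1 < (pi k).+1 < N.+2))) ->
  (forall k : 'I_N.+1, ~~ ((i.+1 < k.+1 < j.+1) && ((pi j).+1 < (pi k).+1 < N.+2))) ->
  (forall k : 'I_N.+1, ~~ ((j.+1 < k.+1 < N.+2) && ((pi j).+1 < (pi k).+1 < N.+2))) ->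
  pi j = ord_max.
Proof.
move=> ij pij h0 h1 h2; apply/val_inj => /=; set k := (pi^-1)%g ord_max.
have pk : pi k = N :> nat by rewrite permKV.
have [kj|kj] := eqVneq (k : nat) j; first by rewrite -[RHS]pk (val_inj kj).
have [ki|ki] := eqVneq (k : nat) i.
  by have := ltn_ord (pi j); move: pij pk; rewrite -(val_inj ki); lia.
by move: (h0 k) (h1 k) (h2 k) (ltn_ord (pi j)) (ltn_ord k); lia.
Qed.

(** Cell (2,1) forces every letter right of the maximum below the first letter, so [e] lists the
    values downwards. *)
Lemma top_row_right_middle_law : distr_law [set (0, 2); (1, 2); (2, 2); (2, 1)]%R.
Proof.
apply: (@prefix_distr_law _ (fun N t => lift ord_max (rev_ord t))
                            (fun N x y => y <= x)).
- by move=> N u t /lift_inj/rev_ord_inj.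
- by move=> N t; rewrite eq_sym neq_lift.
- move=> N x; rewrite eq_sym => /unlift_some[t -> _].
  by exists (rev_ord t); rewrite rev_ordK.
- by move=> N u t; rewrite !lift_max /=; have := ltn_ord u; have := ltn_ord t; lia.
move=> N pi i j; rewrite /mesh_occurrence forall_in_set4 /gridline /=.
apply: (iffP and3P) => [[ij pij]|[ij pj low]].
  case/and4P=> /existsPn h1 /existsPn h2 /existsPn h3 /existsPn h4.
  have pj := top_row_empty ij pij h1 h2 h3; split=> //.
  move=> k jk; have := h4 k; have := ltn_ord k.
  move/(congr1 val): pj => /= pj.
  have : pi k != pi i :> nat by apply: perm_val_neq; lia.
  have : pi k != pi j :> nat by apply: perm_val_neq; lia.
  by have := ltn_ord (pi k); lia.
have pij : pi i != pi j :> nat by apply: perm_val_neq; lia.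
rewrite pj /= in pij *.
split=> //; first by move: (ltn_ord (pi i)); lia.
by apply/and4P; split; apply/existsPn => k; move: (low k) (ltn_ord (pi k)); lia.
Qed.

(** Cell (2,0) forces every letter right of the maximum above the first letter, so [e] lists the
    values upwards. *)
Lemma top_row_right_bottom_law : distr_law [set (0, 2); (1, 2); (2, 2); (2, 0)]%R.
Proof.
apply: (@prefix_distr_law _ (fun N t => lift ord_max t) (fun N x y => x <= y)).
- by move=> N u t /lift_inj.
- by move=> N t; rewrite eq_sym neq_lift.
- by move=> N x; rewrite eq_sym => /unlift_some[t -> _]; exists t.
- by move=> N u t; rewrite !lift_max.
move=> N pi i j; rewrite /mesh_occurrence forall_in_set4 /gridline /=.
apply: (iffP and3P) => [[ij pij]|[ij pj high]].
  case/and4P=> /existsPn h1 /existsPn h2 /existsPn h3 /existsPn h4.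
  have pj := top_row_empty ij pij h1 h2 h3; split=> //.
  move=> k jk; have := h4 k; have := ltn_ord k.
  have : pi k != pi i :> nat by apply: perm_val_neq; lia.
  by lia.
have pij : pi i != pi j :> nat by apply: perm_val_neq; lia.
rewrite pj /= in pij *.
split=> //; first by move: (ltn_ord (pi i)); lia.
by apply/and4P; split; apply/existsPn => k; move: (high k) (ltn_ord (pi k)); lia.
Qed.

(** * Inversion and reverse-complement *)

Lemma mesh_count_le (R R' : shading) n (pi pi' : 'S_n) (f : 'I_n * 'I_n -> 'I_n * 'I_n) :
  injective f ->
  (forall i j, mesh_occurrence R pi i j ->
     mesh_occurrence R' pi' (f (i, j)).1 (f (i, j)).2) ->
  mesh_count R pi <= mesh_count R' pi'.
Proof.
move=> f_inj occ; rewrite /mesh_count -(card_imset _ f_inj).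
apply/subset_leq_card/subsetP => _ /imsetP[[i j] + ->].
by rewrite !inE => /occ.
Qed.

(** Inversion reflects the plot in the diagonal, exchanging positions with values and columns with
    rows. *)
Lemma mesh_occurrence_inv (R R' : shading) n (pi : 'S_n) i j :
  (forall a b, ((a, b) \in R') = ((b, a) \in R)) ->
  mesh_occurrence R pi i j -> mesh_occurrence R' pi^-1 (pi i) (pi j).
Proof.
move=> RR' /and3P[ij pij /forall_inP occ].
rewrite /mesh_occurrence !permK ij pij; apply/forall_inP => -[a b].
rewrite RR' => /occ /existsPn /= h; apply/existsPn => k.
by have := h ((pi^-1)%g k); rewrite permKV andbC.
Qed.

Lemma mesh_distr_inv (R R' : shading) :
  (forall a b, ((a, b) \in R') = ((b, a) \in R)) -> equidistributed R R'.
Proof.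
move=> RR' n k; have R'R a b : ((a, b) \in R) = ((b, a) \in R') by rewrite RR'.
apply: (card_fiber (F := fun q : 'S_n => q^-1%g)) => [|pi]; first exact: invg_inj.
have f_inj (q : 'S_n) : injective (fun p : 'I_n * 'I_n => (q p.1, q p.2)).
  by move=> [? ?] [? ?] [/perm_inj-> /perm_inj->].
apply/eqP; rewrite eqn_leq; apply/andP; split.
  by apply: (mesh_count_le (f_inj pi)) => i j; apply: mesh_occurrence_inv.
apply: (mesh_count_le (f_inj pi^-1%g)) => i j.
by move/(mesh_occurrence_inv R'R); rewrite invgK.
Qed.

Definition rev_comp n (pi : 'S_n) : 'S_n :=
  (perm (@rev_ord_inj n) * pi * perm (@rev_ord_inj n))%g.

Lemma rev_compE n (pi : 'S_n) i : rev_comp pi i = rev_ord (pi (rev_ord i)).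
Proof. by rewrite !permM !permE. Qed.

Lemma rev_compK n : involutive (@rev_comp n).
Proof. by move=> pi; apply/permP => i; rewrite !rev_compE !rev_ordK. Qed.

(** The half-turn z -> n+1-z reverses the grid lines, so the lower edge of a strip becomes the upper
    edge of its image. *)
Lemma gridline_rev n (i j : 'I_n) (a : 'I_3) :
  gridline n (rev_ord j).+1 (rev_ord i).+1 (rev_ord a) =
    n.+1 - gridline n i.+1 j.+1 a.+1 /\
  gridline n (rev_ord j).+1 (rev_ord i).+1 (rev_ord a).+1 =
    n.+1 - gridline n i.+1 j.+1 a.
Proof.
have [] := (ltn_ord i, ltn_ord j).
by case: a => [[|[|[|a]]]] //= _; rewrite /gridline /=; lia.
Qed.

Lemma mesh_occurrence_rev_comp (R R' : shading) n (pi : 'S_n) i j :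
  (forall a b, ((a, b) \in R') = ((rev_ord a, rev_ord b) \in R)) ->
  mesh_occurrence R pi i j ->
  mesh_occurrence R' (rev_comp pi) (rev_ord j) (rev_ord i).
Proof.
move=> RR' /and3P[ij pij /forall_inP occ].
have lt_rev (x y : 'I_n) : x < y -> rev_ord y < rev_ord x.
  by rewrite /=; have := ltn_ord y; lia.
rewrite /mesh_occurrence !rev_compE !rev_ordK !lt_rev //; apply/forall_inP => -[a b].
rewrite RR' => /occ /existsPn /= h; apply/existsPn => k.
have := h (rev_ord k); rewrite rev_compE.
rewrite -[in X in _ -> X](rev_ordK a) -[in X in _ -> X](rev_ordK b).
have [-> ->] := gridline_rev i j (rev_ord a).
have [-> ->] := gridline_rev (pi i) (pi j) (rev_ord b).
have := ltn_ord k; have := ltn_ord (pi (rev_ord k)).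
by rewrite /=; lia.
Qed.

Lemma mesh_distr_rev_comp (R R' : shading) :
  (forall a b, ((a, b) \in R') = ((rev_ord a, rev_ord b) \in R)) ->
  equidistributed R R'.
Proof.
move=> RR' n k.
have R'R a b : ((a, b) \in R) = ((rev_ord a, rev_ord b) \in R').
  by rewrite RR' !rev_ordK.
apply: (card_fiber (F := @rev_comp n)) => [|pi]; first exact: inv_inj (@rev_compK n).
have f_inj : injective (fun p : 'I_n * 'I_n => (rev_ord p.2, rev_ord p.1)).
  by apply: inv_inj => -[a b] /=; rewrite !rev_ordK.
apply/eqP; rewrite eqn_leq; apply/andP; split.
  by apply: (mesh_count_le f_inj) => i j; apply: mesh_occurrence_rev_comp.
apply: (mesh_count_le f_inj) => i j.
by move/(mesh_occurrence_rev_comp R'R); rewrite rev_compK.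
Qed.

(** * The eight shadings *)

Lemma distr_law_equi R R' : equidistributed R R' -> distr_law R -> distr_law R'.
Proof. by move=> RR' law N k; rewrite -RR'; apply: law. Qed.

(** The symmetries split the list into two orbits of four: the first four shadings come from [law1],
    the last four from [law5]. *)
Lemma eight_shadings_law R : R \in eight_shadings -> distr_law R.
Proof.
have law1 := top_row_right_middle_law; have law5 := top_row_right_bottom_law.
have law3 : distr_law [set (1, 2); (2, 2); (2, 1); (2, 0)]%R.
  apply: distr_law_equi law1; apply: mesh_distr_inv.
  by case=> [[|[|[|a]]] ?] [[|[|[|b]]] ?]; rewrite // !inE.
have law4 : distr_law [set (0, 1); (0, 0); (1, 0); (2, 0)]%R.
  apply: distr_law_equi law1; apply: mesh_distr_rev_comp.
  by case=> [[|[|[|a]]] ?] [[|[|[|b]]] ?]; rewrite // !inE.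
have law2 : distr_law [set (0, 2); (0, 1); (0, 0); (1, 0)]%R.
  apply: distr_law_equi law4; apply: mesh_distr_inv.
  by case=> [[|[|[|a]]] ?] [[|[|[|b]]] ?]; rewrite // !inE.
have law6 : distr_law [set (0, 2); (2, 2); (2, 1); (2, 0)]%R.
  apply: distr_law_equi law5; apply: mesh_distr_inv.
  by case=> [[|[|[|a]]] ?] [[|[|[|b]]] ?]; rewrite // !inE.
have law8 : distr_law [set (0, 2); (0, 0); (1, 0); (2, 0)]%R.
  apply: distr_law_equi law5; apply: mesh_distr_rev_comp.
  by case=> [[|[|[|a]]] ?] [[|[|[|b]]] ?]; rewrite // !inE.
have law7 : distr_law [set (0, 2); (0, 1); (0, 0); (2, 0)]%R.
  apply: distr_law_equi law8; apply: mesh_distr_inv.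
  by case=> [[|[|[|a]]] ?] [[|[|[|b]]] ?]; rewrite // !inE.
by rewrite !inE => /or4P[||| /or4P[||| /orP[]]] /eqP->.
Qed.

Lemma mesh_distr_law_unique R R' : distr_law R -> distr_law R' -> equidistributed R R'.
Proof.
move=> law law' [|N] k.
  (* For n = 0, outside the law, there are no positions and both counts vanish. *)
  apply: (card_fiber (F := id)) => // pi.
  by rewrite /mesh_count !eq_card0 // => -[[]].
have [[lt eq gt] [lt' eq' gt']] := (law N k, law' N k).
have [kN|Nk|kN] := ltngtP k N; last by rewrite eq ?eq'.
  by apply/eqP; rewrite -(eqn_pmul2r (isT : 0 < k.+1 * k.+2)) lt ?lt'.
by rewrite gt ?gt'.
Qed.

Theorem theorem3p4 :
  (forall R1 R2 : shading, R1 \in eight_shadings -> R2 \in eight_shadings ->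
     equidistributed R1 R2) /\
  (forall R : shading, R \in eight_shadings ->
     (forall n : nat, 1 <= n -> mesh_distr R n (n - 1) = (n - 1)`!) /\
     (forall n k : nat, 2 <= n -> k <= n - 2 ->
        ((mesh_distr R n k)%:R = n`!%:R / ((k + 1)%:R * (k + 2)%:R) :> rat)%R)).
Proof.
split=> [R1 R2 /eight_shadings_law law1 /eight_shadings_law law2|
        R /eight_shadings_law law].
  exact: mesh_distr_law_unique.
split=> [[//|N] _|[//|N] k N2 kN].
  by rewrite subn1 /=; have [_ ->] := law N N.
(* As n = N+1 >= 2, the truncated n - 2 is exact and k <= n - 2 means k < N. *)
have [lt _ _] := law N k; rewrite -lt; last by lia.
by rewrite addn1 addn2 -natrM natrM mulfK // pnatr_eq0.
Qed.
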